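(* Let $u_\epsilon\ge 0$ be a function in $\mathcal C^{2,1}_{x,t}(U_T)$. If $L_\epsilon u_\epsilon\ge 0$ in $U_T$, then $u_\epsilon\ge \min_{\Gamma(U_T)}u_\epsilon$ in $U_T$.
   Context: Let $d\ge 1$, let $U\subset\mathbb R^d$ be a bounded domain, $T>0$, $U_T=U\times(0,T]$, and let $\Gamma(U_T)=(\overline U\times\{t=0\})\cup(\partial U\times(0,T])$ be its parabolic boundary. $\mathcal C^{2,1}_{x,t}(U_T)$ denotes the class of continuous functions on $\overline{U_T}$ having two continuous derivatives in $x$ and one continuous derivative in $t$ inside $U_T$. Fix constants $\tau_0>0$, $\sigma^2>0$, $\Delta^e\in\mathbb R$, $\gamma>0$, $\beta\ge 0$, $\epsilon>0$. The regularized nonlinear operator $L_\epsilon$ is $$L_\epsilon u=\tau_0\frac{\partial u}{\partial t}+(u+\epsilon)^\gamma\big(|\nabla u|^\beta+\epsilon\big)\,\Delta^e\sum_{i=1}^d\frac{\partial u}{\partial x_i}-\frac{\sigma^2}{2}(u+\epsilon)^\gamma\big(|\nabla u|^\beta+\epsilon\big)\,\Delta u,$$ where $\nabla$ and $\Delta u=\sum_i\partial^2u/\partial x_i^2$ are the spatial gradient and Laplacian ($\Delta^e$ is a real constant, not an operator), and $|\cdot|$ is the Euclidean norm. *)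

(* Defs.v *)
From HB Require Import structures.
From mathcomp Require Import all_boot all_order all_algebra.
From mathcomp Require Import all_classical all_reals all_analysis.

Set Implicit Arguments.
Unset Strict Implicit.
Unset Printing Implicit Defensive.

Import Order.TTheory GRing.Theory Num.Theory.
Import numFieldNormedType.Exports.
Local Open Scope classical_set_scope.
Local Open Scope ring_scope.

Section ParabolicNotions.
Context {R : realType} {d : nat}.
Implicit Types (U : set 'rV[R]_d) (T : R) (u : 'rV[R]_d * R -> R).

Definition bounded_domain U :=
  [/\ open U, connected U, U !=set0 & bounded_set U].

Definition frontier U := closure U `\` U°.

Definition cylinder U T : set ('rV[R]_d * R) := U `*` `]0, T].

Definition parabolic_boundary U T : set ('rV[R]_d * R) :=
  (closure U `*` [set 0]) `|` (frontier U `*` `]0, T]).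

Definition e_ (i : 'I_d) : 'rV[R]_d := delta_mx 0 i.

Definition partial_x (i : 'I_d) u (p : 'rV[R]_d * R) : R :=
  'D_(e_ i) (fun y => u (y, p.2)) p.1.

Definition has_partial_x (i : 'I_d) u (p : 'rV[R]_d * R) : Prop :=
  derivable (fun y => u (y, p.2)) p.1 (e_ i).

(* The time derivative is taken relative to ]0, T]: it is the usual two-sided
   derivative for 0 < t < T and the left derivative at the final time t = T. *)
Definition time_quotient u (p : 'rV[R]_d * R) (h : R) : R :=
  h^-1 * (u (p.1, p.2 + h) - u p).

Definition time_increments T (t : R) : set_system R :=
  within [set h | 0 < t + h <= T] 0^'.

Definition partial_t T u (p : 'rV[R]_d * R) : R :=
  lim (time_quotient u p @ time_increments T p.2).

Definition has_partial_t T u (p : 'rV[R]_d * R) : Prop :=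
  cvg (time_quotient u p @ time_increments T p.2).

(* Only the values of u on the closed cylinder are constrained; u is a total
   function for convenience. Derivatives exist and are continuous on all of
   the cylinder, final time included. *)
Definition C21 U T u : Prop :=
  [/\ {within closure (cylinder U T), continuous u},
      forall i, (forall p, cylinder U T p -> has_partial_x i u p) /\
                {within cylinder U T, continuous (partial_x i u)},
      forall i j,
        (forall p, cylinder U T p -> has_partial_x j (partial_x i u) p) /\
        {within cylinder U T, continuous (partial_x j (partial_x i u))} &
      (forall p, cylinder U T p -> has_partial_t T u p) /\
      {within cylinder U T, continuous (partial_t T u)}].

(* The norm `|_| of 'rV[R]_d is the sup norm, hence the explicit formula. *)
Definition grad_norm u (p : 'rV[R]_d * R) : R :=
  Num.sqrt (\sum_(i < d) partial_x i u p ^+ 2).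

Definition laplacian u (p : 'rV[R]_d * R) : R :=
  \sum_(i < d) partial_x i (partial_x i u) p.

(* [Deltae] is a real constant. For beta = 0, `|grad u| `^ beta is 1 even where
   the gradient vanishes. *)
Definition L_op (tau0 sigma Deltae gamma beta eps T : R) u
    (p : 'rV[R]_d * R) : R :=
  tau0 * partial_t T u p
  + (u p + eps) `^ gamma * (grad_norm u p `^ beta + eps) * Deltae
    * (\sum_(i < d) partial_x i u p)
  - sigma ^+ 2 / 2 * (u p + eps) `^ gamma * (grad_norm u p `^ beta + eps)
    * laplacian u p.

Definition is_min_on (A : set ('rV[R]_d * R)) u (m : R) : Prop :=
  (u @` A) m /\ lbound (u @` A) m.

End ParabolicNotions.

(* Main.v *)
Require Import Defs.
From mathcomp Require Import all_boot all_order all_algebra.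
From mathcomp Require Import all_classical all_reals all_analysis.
Import Order.TTheory GRing.Theory Num.Theory.
Import numFieldNormedType.Exports.
Local Open Scope classical_set_scope.
Local Open Scope ring_scope.

(** The nonlinearity is harmless at a spatial minimum: there the gradient
    vanishes, which kills the drift term, and the diffusion term is a nonnegative
    coefficient times the Laplacian.  Only the weak inequality [0 <= L u] is available,
    so strictness is gained in time: let [delta > 0] and minimize
    [v = u + delta * t] over the compact set [closure U `*` [0, T]].

    If the minimum were reached at a point of the cylinder, then there the
    spatial gradient of [u] would vanish and its pure second derivatives would
    be nonnegative ([partial_x_interior_min]), while comparing with earlier
    times only would give [u_t <= - delta] ([partial_t_le]); looking backwards
    is what makes the final time [T] harmless.  Hence
    [L u <= - tau0 * delta < 0] ([L_op_lt0_at_min]), a contradiction.  So [v]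
    reaches its minimum on the parabolic boundary, where [u <= v], and
    [min u <= v p <= u p + delta * T] at every point [p] of the cylinder.
    Letting [delta] tend to 0 gives the result.  The perturbation is added to
    [u] only inside the minimization and [L] is always applied to [u] itself,
    so the nonlinearity of [L] never has to be compared at two functions.

    The minimum over the parabolic boundary exists because that set is the
    compact closed cylinder minus an open set ([parabolic_boundaryE]). *)

(** * Derivatives along a line *)

(** A directional derivative is a one-variable derivative along the line
    [r |-> r *: v + a], because the two difference quotients agree; derivability
    and the value of the derivative are both read off from this equality. *)
Lemma quotient_line (R : realType) (V : normedModType R) (f : V -> R)
    (a v : V) (s : R) :
  (fun h : R => h^-1 *: ((f \o shift (s *: v + a)) (h *: v) - f (s *: v + a))) =
  (fun h : R => h^-1 *: (((fun r : R => f (r *: v + a)) \o shift s) (h *: 1) -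
                         f (s *: v + a))).
Proof. by apply/funext => h /=; rewrite scalerDl addrA /GRing.scale/= mulr1. Qed.

Lemma derivable_line (R : realType) (V : normedModType R) (f : V -> R)
    (a v : V) (s : R) :
  derivable f (s *: v + a) v <-> derivable (fun r : R => f (r *: v + a)) s 1.
Proof. by rewrite /derivable quotient_line. Qed.

Lemma derive_line (R : realType) (V : normedModType R) (f : V -> R)
    (a v : V) (s : R) :
  'D_v f (s *: v + a) = derive1 (fun r : R => f (r *: v + a)) s.
Proof. by rewrite derive1E /derive quotient_line. Qed.

(** * Necessary conditions at a minimum *)

Lemma derive1_local_min (R : realType) (g : R -> R) (a : R) :
  (\forall x \near a, derivable g x 1) -> (\forall x \near a, g a <= g x) ->
  derive1 g a = 0.
Proof.
move=> dg ming.
have /nbhs_ballP[e /= e0 He] : \forall x \near a, derivable g x 1 /\ g a <= g x.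
  by near=> x; split; near: x.
have Hb x : x \in `]a - e, a + e[ -> derivable g x 1 /\ g a <= g x.
  by rewrite in_itv => xe; apply: He; rewrite -ball_normE /= ltr_distlC.
rewrite derive1E; apply: derive_val.
apply: (@derive1_at_min _ g (a - e) (a + e)).
- by rewrite lerD2l ge0_cp// ltW.
- by move=> x /Hb[].
- by rewrite in_itv/= ltrBlDr !ltrDl e0.
- by move=> x /Hb[].
Unshelve. all: by end_near. Qed.

(** If the second derivative were negative, the first derivative, which
    vanishes at [a], would be negative just to the right of [a]; the mean value
    theorem would then make [g] drop below [g a]. *)
Lemma derive1_derive1_local_min (R : realType) (g : R -> R) (a : R) :
  (\forall x \near a, derivable g x 1) -> (\forall x \near a, g a <= g x) ->
  derivable (derive1 g) a 1 -> 0 <= derive1 (derive1 g) a.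
Proof.
move=> dg ming ddg; have g'a0 := derive1_local_min _ _ _ dg ming.
rewrite leNgt; apply/negP => g''_lt0.
have cvq : h^-1 * derive1 g (a + h) @[h --> 0^'+] --> derive1 (derive1 g) a.
  have cq : (fun h : R => h^-1 *: ((derive1 g \o shift a) (h *: 1) - derive1 g a))
      @ 0^' --> derive1 (derive1 g) a.
    by rewrite (derive1E (derive1 g)); exact: ddg.
  suff -> : (fun h => h^-1 * derive1 g (a + h)) =
      (fun h : R => h^-1 *: ((derive1 g \o shift a) (h *: 1) - derive1 g a)).
    exact: cvg_dnbhs_at_right cq.
  by apply/funext => h /=; rewrite g'a0 subr0 /GRing.scale/= mulr1 addrC.
have g'_lt0 : \forall h \near 0^'+, derive1 g (a + h) < 0.
  apply: filterS2 (nbhs_right_gt 0) (cvgr_lt _ cvq _ g''_lt0) => h h0.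
  by rewrite pmulr_rlt0// invr_gt0.
have shift0 (P : set R) : (\forall x \near a, P x) ->
    \forall h \near 0^'+, P (a + h).
  by move=> aP; apply/(nbhs_right0P a P); apply: cvg_within aP.
have dg' := shift0 _ dg; have ming' := shift0 _ ming.
have : \forall h \near 0^'+,
    [/\ derive1 g (a + h) < 0, derivable g (a + h) 1 & g a <= g (a + h)].
  by near=> h; split; near: h.
move=> /nbhs_ballP[e /= e0 He].
have e2 : 0 < e / 2 by rewrite divr_gt0.
have P0 h : 0 < h -> h <= e / 2 ->
    [/\ derive1 g (a + h) < 0, derivable g (a + h) 1 & g a <= g (a + h)].
  move=> h0 he; apply: He => //; rewrite -ball_normE /= sub0r normrN gtr0_norm//.
  by rewrite (le_lt_trans he)// ltr_pdivrMr// ltr_pMr// ltr1n.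
have P c : a < c -> c <= a + e / 2 ->
    [/\ derive1 g c < 0, derivable g c 1 & g a <= g c].
  move=> ac ce; rewrite -(subrKC a c); apply: P0; first by rewrite subr_gt0.
  by rewrite lerBlDl.
(* The mean value theorem on [a, a + e / 2] contradicts minimality. *)
have aae : a < a + e / 2 by rewrite ltrDl.
have dgs x : x \in `]a, a + e / 2[ -> is_derive x 1 g (derive1 g x).
  rewrite in_itv/= => /andP[ax /ltW xe]; rewrite derive1E; apply/derivableP.
  by have [] := P x ax xe.
have cg : {within `[a, a + e / 2], continuous g}.
  apply: derivable_within_continuous => x; rewrite in_itv/= => /andP[].
  rewrite le_eqVlt => /predU1P[<- _|ax xe]; first exact: nbhs_singleton dg.
  by have [] := P x ax xe.
have [c cI gc] := MVT aae dgs cg.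
have [_ _] := P _ aae (lexx _); apply/negP; rewrite -ltNge -subr_lt0 gc.
move: cI; rewrite in_itv/= => /andP[ac /ltW ce]; have [g'c _ _] := P c ac ce.
by rewrite pmulr_llt0// subr_gt0.
Unshelve. all: by end_near. Qed.

(** Along the line through [x] in the direction [e_ i] the point is a local
    minimum of a function of one variable, [U] being open, whose first and second
    derivatives are the iterated partial derivatives. *)
Lemma partial_x_interior_min (R : realType) (d : nat) (U : set 'rV[R]_d)
    (u : 'rV[R]_d * R -> R) (i : 'I_d) (x : 'rV[R]_d) (t : R) :
  open U -> U x -> (forall y, U y -> u (x, t) <= u (y, t)) ->
  (forall y, U y -> has_partial_x i u (y, t)) ->
  has_partial_x i (partial_x i u) (x, t) ->
  partial_x i u (x, t) = 0 /\ 0 <= partial_x i (partial_x i u) (x, t).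
Proof.
move=> oU Ux ux du ddu; pose v : 'rV[R]_d := e_ i.
pose g (r : R) := u (r *: v + x, t).
have x0 : x = 0 *: v + x by rewrite scale0r add0r.
have dgE : derive1 g = fun r => partial_x i u (r *: v + x, t).
  by apply/funext => r; rewrite /partial_x -(derive_line _ _ (fun y => u (y, t))).
have nearU : \forall r \near (0 : R), U (r *: v + x).
  have cv : r *: v + x @[r --> (0 : R)] --> 0 *: v + x.
    by apply: cvgD; [apply: cvgZr_tmp; exact: cvg_id|exact: cvg_cst].
  by apply: cv; rewrite -x0; exact: open_nbhs_nbhs.
have dg : \forall r \near (0 : R), derivable g r 1.
  apply: filterS nearU => r /du.
  by rewrite /has_partial_x/= derivable_line.
have ming : \forall r \near (0 : R), g 0 <= g r.
  by apply: filterS nearU => r /ux; rewrite /g -x0.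
split; first by rewrite -(derive1_local_min _ _ _ dg ming) dgE -x0.
have -> : partial_x i (partial_x i u) (x, t) = derive1 (derive1 g) 0.
  by rewrite dgE -(derive_line _ _ (fun y => partial_x i u (y, t))) -x0.
apply: (derive1_derive1_local_min _ _ _ dg ming); rewrite dgE.
by have [+ _] := derivable_line _ _ (fun y => partial_x i u (y, t)) x v 0;
  apply; rewrite -x0.
Qed.

(** The quotients with [h < 0] are all admissible, also at [t = T], so their
    limit from the left is the time derivative; a bound on the past increments
    alone therefore bounds it. *)
Lemma partial_t_le (R : realType) (d : nat) (u : 'rV[R]_d * R -> R)
    (x : 'rV[R]_d) (T t c : R) :
  0 < t <= T -> has_partial_t T u (x, t) ->
  (forall s, 0 < s < t -> u (x, t) - u (x, s) <= c * (t - s)) ->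
  partial_t T u (x, t) <= c.
Proof.
move=> /andP[t0 tT] du uc.
have sub : time_quotient u (x, t) @ 0^'- `=>`
    time_quotient u (x, t) @ time_increments T t.
  move=> A; set q := time_quotient u (x, t) => HA.
  have HA0 : \forall h \near (0 : R), h != 0 -> 0 < t + h <= T -> A (q h).
    exact: HA.
  have tnear : \forall h \near (0 : R), - t < h.
    by apply: lt_nbhsr; rewrite oppr_lt0.
  suff : \forall h \near (0 : R), h < 0 -> A (q h) by [].
  near=> h => h0; have th : - t < h by near: h.
  have h_neq0 : h != 0 by rewrite lt_eqF.
  suff : 0 < t + h <= T by move: h_neq0; near: h.
  by rewrite -ltrBlDl sub0r th /= (le_trans _ tT)// gerDl ltW.
have cvq : time_quotient u (x, t) @ 0^'- --> partial_t T u (x, t).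
  exact: cvg_trans sub du.
rewrite -(cvg_lim (@norm_hausdorff _ _) cvq); apply: limr_le.
  by apply/cvg_ex; eexists; exact: cvq.
near=> h; have h0 : h < 0 by near: h; exact: nbhs_left_lt.
have th : - t < h by near: h; apply: nbhs_left_gt; rewrite oppr_lt0.
rewrite /time_quotient/= mulrC ler_ndivrMr//.
have := uc (t + h); rewrite -ltrBlDl sub0r th gtrDl h0 => /(_ isT).
rewrite opprD addrA subrr sub0r mulrN => H.
by rewrite -lerN2 opprB.
Unshelve. all: by end_near. Qed.

(** * The operator at a minimum of the perturbed function *)

(** The contradiction behind the maximum principle: tilting by [delta * t] turns
    minimality into a strict sign for the time derivative, and the elliptic part
    can only lower [L u] further. *)
Lemma L_op_lt0_at_min (R : realType) (d : nat) (U : set 'rV[R]_d)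
    (T tau0 sigma Deltae gamma beta eps delta : R)
    (u : 'rV[R]_d * R -> R) (p : 'rV[R]_d * R) :
  open U -> 0 < tau0 -> 0 < eps -> 0 < delta -> C21 U T u -> cylinder U T p ->
  (forall q, cylinder U T q -> u p + delta * p.2 <= u q + delta * q.2) ->
  L_op tau0 sigma Deltae gamma beta eps T u p < 0.
Proof.
case: p => x t oU tau0_gt0 eps_gt0 delta_gt0 [_ ux uxx [ut _]] [/= Ux].
rewrite in_itv/= => t0T umin.
have inU y : U y -> cylinder U T (y, t) by move=> Uy; split => //=; rewrite in_itv.
have dx i : partial_x i u (x, t) = 0 /\ 0 <= partial_x i (partial_x i u) (x, t).
  apply: (partial_x_interior_min _ _ _ _ _ _ _ oU Ux).
  - by move=> y /inU /umin /=; rewrite lerD2r.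
  - by move=> y /inU; have [+ _] := ux i; apply.
  - by have [+ _] := uxx i i; apply; exact: inU.
have dt : partial_t T u (x, t) <= - delta.
  apply: (partial_t_le _ _ _ _ _ _ _ t0T); first by apply: ut; exact: inU.
  move=> s /andP[s0 st]; case/andP: t0T => t0 tT.
  have /umin/= : cylinder U T (x, s).
    by split => //=; rewrite in_itv/= s0 (le_trans (ltW st)).
  by rewrite mulNr -mulrN opprB mulrBr lerBlDr addrAC lerBrDr [leRHS]addrC.
have grad0 : \sum_(i < d) partial_x i u (x, t) = 0.
  by apply: big1 => i _; have [] := dx i.
have lap_ge0 : 0 <= laplacian u (x, t).
  by apply: sumr_ge0 => i _; have [] := dx i.
rewrite /L_op grad0 mulr0 addr0 subr_lt0.
apply: (@lt_le_trans _ _ 0).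
  by rewrite pmulr_rlt0// (le_lt_trans dt)// oppr_lt0.
apply: mulr_ge0 lap_ge0; apply: mulr_ge0.
  by rewrite mulr_ge0 ?powR_ge0// divr_ge0// sqr_ge0.
by rewrite addr_ge0 ?powR_ge0// ltW.
Qed.

(** * Compactness of the closed cylinder and of the parabolic boundary *)

Lemma closure_setX_sub (X Y : topologicalType) (A : set X) (B : set Y) :
  closure A `*` closure B `<=` closure (A `*` B).
Proof.
move=> [x y] [/= Ax By] C [[C1 C2] /= [C1x C2y] C12C].
have [x' [Ax' C1x']] := Ax _ C1x; have [y' [By' C2y']] := By _ C2y.
by exists (x', y'); split => //; apply: C12C.
Qed.

Lemma closure_itvoc_ge (R : realType) (T : R) :
  0 < T -> `[0, T]%classic `<=` closure (`]0, T]%classic : set R).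
Proof.
move=> T0 t /=; rewrite in_itv/= => /andP[].
rewrite le_eqVlt => /predU1P[<- _|t0 tT].
  move=> B B0.
  suff : \forall x \near 0^'+, `]0, T]%classic x /\ B x by move/filter_ex.
  near=> x; split; last by near: x; exact: (@cvg_within _ (nbhs 0) _ _ B B0).
  rewrite /= in_itv/=; apply/andP; split; near: x; first exact: nbhs_right_gt.
  exact: nbhs_right_le.
by apply: subset_closure; rewrite /= in_itv/= t0.
Unshelve. all: by end_near. Qed.

Lemma bounded_closure (R : realType) (V : normedModType R) (A : set V) :
  bounded_set A -> bounded_set (closure A).
Proof.
rewrite /= /bounded_near; apply: filterS => M AM x clAx.
have clM : closed [set y : V | `|y| <= M].
  apply: (@closed_comp _ _ (fun y : V => `|y|) [set r | r <= M]);
    last exact: closed_le.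
  by move=> y _; exact: norm_continuous.
by apply: clM; apply: closure_subset clAx.
Qed.

(** Continuity of [u] is known on the closure of the cylinder; this transfers it
    to the compact set on which the minimization takes place.  The base at
    [t = 0] lies in that closure although [0] is not in [`]0, T]]. *)
Lemma closed_cylinder_sub (R : realType) (d : nat) (U : set 'rV[R]_d)
    (T : R) :
  0 < T -> closure U `*` `[0, T] `<=` closure (cylinder U T).
Proof.
move=> T0 [x t] [/= clUx /(closure_itvoc_ge _ _ T0) clt].
exact: closure_setX_sub.
Qed.

Lemma compact_closed_cylinder (R : realType) (d : nat) (U : set 'rV[R]_d)
    (T : R) :
  bounded_set U -> compact (closure U `*` (`[0, T]%classic : set R)).
Proof.
move=> bU; apply: compact_setX; last exact: segment_compact.
by apply: bounded_closed_compact; [exact: bounded_closure|exact: closed_closure].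
Qed.

(** Removing the open set [U `*` `]0, +oo[] from the closed cylinder leaves a
    closed set; this form also says that a point of the closed cylinder which
    is not on the parabolic boundary lies in the cylinder. *)
Lemma parabolic_boundaryE (R : realType) (d : nat) (U : set 'rV[R]_d)
    (T : R) :
  open U -> 0 < T ->
  parabolic_boundary U T =
  (closure U `*` `[0, T]) `&` ~` [set p : 'rV[R]_d * R | U p.1 /\ 0 < p.2].
Proof.
rewrite interior_id => intU T0.
apply/seteqP; split => -[x t];
  rewrite /parabolic_boundary /frontier intU/= !in_itv/=.
  move=> [[clx /= ->]|[[clx nUx] /andP[t0 tT]]].
    by rewrite lexx ltW// ltxx; split => // -[].
  by rewrite tT (ltW t0); split => // -[].
move=> [[clx /andP[+ tT]] nUt]; rewrite le_eqVlt => /predU1P[<-|t0].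
  by left.
by right; rewrite t0 tT; split => //; split => // Ux; exact: nUt.
Qed.

Lemma compact_parabolic_boundary (R : realType) (d : nat) (U : set 'rV[R]_d)
    (T : R) :
  open U -> bounded_set U -> 0 < T -> compact (parabolic_boundary U T).
Proof.
move=> oU bU T0; rewrite parabolic_boundaryE//.
apply: compact_closedI; first exact: compact_closed_cylinder.
apply: open_closedC.
rewrite [X in open X](_ : _ = fst @^-1` U `&` snd @^-1` [set r | 0 < r])//.
apply: openI; apply: open_comp => //.
- by move=> [x t] _; exact: cvg_fst.
- by move=> [x t] _; exact: cvg_snd.
Qed.

(** * The minimum principle *)

Theorem theorem1 (R : realType) (d : nat) (d_ge1 : (1 <= d)%N)
    (U : set 'rV[R]_d) (U_dom : bounded_domain U) (T : R) (T_gt0 : 0 < T)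
    (tau0 sigma Deltae gamma beta eps : R)
    (tau0_gt0 : 0 < tau0) (sigma2_gt0 : 0 < sigma ^+ 2) (gamma_gt0 : 0 < gamma)
    (beta_ge0 : 0 <= beta) (eps_gt0 : 0 < eps)
    (u : 'rV[R]_d * R -> R) (u_C21 : C21 U T u)
    (u_ge0 : forall p, closure (cylinder U T) p -> 0 <= u p)
    (Lu_ge0 : forall p, cylinder U T p ->
       0 <= L_op tau0 sigma Deltae gamma beta eps T u p) :
  exists m : R, is_min_on (parabolic_boundary U T) u m /\
    forall p, cylinder U T p -> m <= u p.
Proof.
have [oU _ U0 bU] := U_dom; have [cu _ _ _] := u_C21.
set K := closure U `*` (`[0, T]%classic : set R).
have cK : compact K by exact: compact_closed_cylinder.
have cuK : {within K, continuous u}.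
  by apply: continuous_subspaceW cu; exact: closed_cylinder_sub.
have GK : parabolic_boundary U T `<=` K.
  by rewrite parabolic_boundaryE// => p [].
have G0 : parabolic_boundary U T !=set0.
  by have [x Ux] := U0; exists (x, 0); left; split => //=; exact: subset_closure.
have [q /set_mem Gq qmin] := compact_EVT_min G0
  (compact_parabolic_boundary _ _ _ _ oU bU T_gt0) (continuous_subspaceW GK cuK).
exists (u q); split.
  by split; [exists q|move=> _ [r Gr <-]; apply: qmin; rewrite inE].
move=> p [/= Up]; rewrite in_itv/= => /andP[p0 pT].
apply/ler_addgt0Pr => e e_gt0.
(* Times range up to T, so this slope perturbs u by at most e. *)
pose delta := e / T; have delta_gt0 : 0 < delta by rewrite divr_gt0.
pose v r : R := u r + delta * r.2.
have cv : {within K, continuous v}.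
  apply: (@within_continuousD _ _ _ K u (fun r => delta * r.2)) => //.
  apply: continuous_subspaceT => -[x t] /=.
  by apply: cvgM; [exact: cvg_cst|exact: cvg_snd].
have Kp : K p by split => /=; [exact: subset_closure|rewrite in_itv/= ltW].
have [r /set_mem Kr rmin] := compact_EVT_min (ex_intro _ _ Kp) cK cv.
(* A minimizer off the parabolic boundary would make L u negative there. *)
have Gr : parabolic_boundary U T r.
  rewrite parabolic_boundaryE//; split=> // -[Ur r0].
  have Cr : cylinder U T r.
    split => //=; rewrite in_itv/= r0 /=.
    by case: Kr => _; rewrite /= in_itv/= => /andP[].
  have := Lu_ge0 _ Cr; rewrite leNgt => /negP; apply.
  apply: (L_op_lt0_at_min _ _ U _ _ _ _ _ _ _ delta) => // s [Us].
  rewrite /= in_itv/= => /andP[s0 sT]; apply: rmin; apply/mem_set.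
  by split => /=; [exact: subset_closure|rewrite in_itv/= ltW].
have r2_ge0 : 0 <= r.2 by case: Kr => _; rewrite /= in_itv/= => /andP[].
have qr : u q <= v r.
  apply: (le_trans (qmin r _)); first by rewrite inE.
  by rewrite lerDl mulr_ge0// ltW.
have rp : v r <= v p by apply: rmin; rewrite inE.
rewrite (le_trans qr)// (le_trans rp)// lerD2l /delta mulrAC ler_pdivrMr//.
by rewrite ler_pM2l.
Qed.
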